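(* Let $\mathbf P=(P,\le,1)$ be a poset with greatest element $1$, let $\mathbf Q=(Q,\le,0)$ be a poset with least element $0$, let $a\in P$, $b\in Q$, and let $g$ be an order isomorphism from $([a,1],\le)$ to $([0,b],\le)$. Assume $P=(\downarrow a)\cup[a,1]$ and $Q=[0,b]\cup(\uparrow b)$, and define $f\colon P\to Q$ by \[ f(x):=\begin{cases} 0 & \text{if }x\le a,\\ g(x) & \text{otherwise.}\end{cases} \] Then $f$ is a weakly regular residuated mapping from $\mathbf P$ to $\mathbf Q$.
   Context: $\downarrow a=\{x\in P\mid x\le a\}$, $\uparrow b=\{y\in Q\mid b\le y\}$, and $[u,v]=\{x\mid u\le x\le v\}$. An order isomorphism is a bijection $g$ with $x\le y$ if and only if $g(x)\le g(y)$. A mapping $f\colon P\to Q$ between posets is residuated if there is a mapping $f^*\colon Q\to P$ such that for all $x\in P$, $y\in Q$: $f(x)\le y$ if and only if $x\le f^*(y)$; such $f^*$ is uniquely determined by $f$. For $\mathbf P$ with greatest element $1$ and $\mathbf Q$ with least element $0$, a residuated mapping $f$ is called range-closed if $f(P)=[0,f(1)]$, dually range-closed if $f^*(Q)=[f^*(0),1]$, and weakly regular if it is both range-closed and dually range-closed. *)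

(* Defs.v *)
From HB Require Import structures.
From mathcomp Require Import all_boot all_order.
From mathcomp Require Import interval.
From mathcomp Require Import boolp classical_sets functions set_interval.
Set Implicit Arguments.
Unset Strict Implicit.
Unset Printing Implicit Defensive.
Import Order.Theory.
Local Open Scope order_scope.
Local Open Scope classical_set_scope.

Section OrderIso.
Context {d d' : Order.disp_t} {P : porderType d} {Q : porderType d'}.

(* Only the values of g on A matter. *)
Definition order_iso_on (A : set P) (B : set Q) (g : P -> Q) : Prop :=
  set_bij A B g /\
  (forall x y : P, A x -> A y -> (x <= y <-> g x <= g y)).

Definition is_residual (f : P -> Q) (fs : Q -> P) : Prop :=
  forall (x : P) (y : Q), f x <= y <-> x <= fs y.

Definition residuated (f : P -> Q) : Prop := exists fs, is_residual f fs.

Lemma is_residual_unique (f : P -> Q) (fs fs' : Q -> P) :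
  is_residual f fs -> is_residual f fs' -> fs = fs'.
Proof.
move=> h h'; apply/funext => y; apply/le_anti/andP; split.
- by apply/h'/h.
- by apply/h/h'.
Qed.

End OrderIso.

Section WeaklyRegular.
Context {d d' : Order.disp_t} {P : tPOrderType d} {Q : bPOrderType d'}.

Definition range_closed (f : P -> Q) : Prop := range f = `[\bot, f \top].

(* The residual is unique (is_residual_unique), so quantifying existentially
   over it amounts to speaking of the residual of f. *)
Definition dually_range_closed (f : P -> Q) : Prop :=
  exists2 fs : Q -> P, is_residual f fs & range fs = `[fs \bot, \top].

Definition weakly_regular (f : P -> Q) : Prop :=
  range_closed f /\ dually_range_closed f.

End WeaklyRegular.

(* Main.v *)
(** The isomorphism forces [g a = 0] and [g 1 = b].  For [z >= a] one has [f x <= g z] iff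
[x <= z], so the residual sends [g z] to [z], and every [y >= b] to [1]; hence
its range is all of [[a, 1]], with [a] the image of [0]. *)
Require Import Defs.
From HB Require Import structures.
From mathcomp Require Import all_boot all_order.
From mathcomp Require Import interval.
From mathcomp Require Import boolp classical_sets functions set_interval.
Import Order.Theory.
Local Open Scope order_scope.
Local Open Scope classical_set_scope.

Theorem theorem5p5 (d d' : Order.disp_t)
    (P : tPOrderType d) (Q : bPOrderType d') (a : P) (b : Q) (g : P -> Q)
    (hg : order_iso_on `[a, \top] `[\bot, b] g)
    (hP : [set: P] = `]-oo, a] `|` `[a, \top])
    (hQ : [set: Q] = `[\bot, b] `|` `[b, +oo[) :
  let f := fun x : P => if x <= a then \bot else g x in
  residuated f /\ weakly_regular f.
Proof.
move=> f; case: hg => [[gim _ gsurj] gle].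
have inA z : `[a, \top] z = (a <= z) :> Prop.
  by rewrite /= in_itv /= lex1 andbT.
have inB y : `[\bot, b] y = (y <= b) :> Prop by rewrite /= in_itv /= le0x.
have gleb z : a <= z -> g z <= b by move=> az; rewrite -inB; apply: gim; rewrite inA.
have gonto y : y <= b -> exists2 z, a <= z & g z = y.
  by rewrite -inB => /gsurj[z]; rewrite inA; exists z.
have gmono x z : a <= x -> a <= z -> (g x <= g z <-> x <= z).
  by move=> ax az; apply: iff_sym; apply: gle; rewrite inA.
have ga : g a = \bot.
  (* The preimage [z] of [\bot] lies above [a], so [g a <= g z = \bot]; dually below, the preimage
     of [b] lies under [\top]. *)
  have [z az gz] := gonto _ (le0x b).
  by apply/le_anti; rewrite le0x andbT -gz; apply/gmono.
have gtop : g \top = b.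
  have [z az gz] := gonto _ (lexx b).
  apply/le_anti; rewrite gleb ?lex1 //= -gz.
  by apply/gmono; rewrite ?lex1.
have Ptot x : x <= a \/ a <= x.
  have : [set: P] x by [].
  by rewrite hP => -[|]; [rewrite /= in_itv /=; left | rewrite inA; right].
have Qtot y : y <= b \/ b <= y.
  have : [set: Q] y by [].
  by rewrite hQ => -[|]; [rewrite inB; left | rewrite /= in_itv /= andbT; right].
have fE z : a <= z -> f z = g z.
  (* The first branch of [f] meets the interval from [a] to [\top] only at [a], where its value
     [\bot] is [g a]. *)
  rewrite /f; case: ifP => // za az.
  by rewrite -ga; congr g; apply/le_anti; rewrite az.
have f_le_g x z : a <= z -> (f x <= g z <-> x <= z).
  move=> az; have [xa|ax] := Ptot x; last by rewrite fE //; apply: gmono.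
  (* For [x <= a] both sides hold: [f x] is [\bot], and [x <= a <= z]. *)
  by rewrite /f xa le0x (le_trans xa az).
have ftop : f \top = b by rewrite fE ?lex1.
have fleb x : f x <= b by rewrite -gtop; apply/f_le_g; rewrite lex1.
(* The conjunct [a <= z] is carried along to keep the range of [fs] above [a]. *)
have /choice[fs fsP] y : exists z, a <= z /\ forall x, f x <= y <-> x <= z.
  have [/gonto[z az <-]|lby] := Qtot y.
    by exists z; split=> // x; apply: f_le_g.
  (* A [y] above [b] bounds every value of [f], so the condition on [x] is vacuous. *)
  exists \top; split=> [|x]; first exact: lex1.
  by rewrite lex1 (le_trans (fleb x) lby).
have fs_res : is_residual f fs by move=> x y; apply: (fsP y).2.
have fsg z : a <= z -> fs (g z) = z.
  move=> az; apply/le_anti/andP; split.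
    by apply/(f_le_g _ _ az)/fs_res.
  by apply/fs_res/f_le_g.
split; first by exists fs.
split.
  rewrite /range_closed ftop; apply/seteqP; split=> y.
    by move=> [x _ <-]; rewrite inB.
  by rewrite inB => /gonto[z az <-]; exists z; rewrite ?fE.
(* Reading [\bot] as [g a] turns the lower endpoint [fs \bot] into [a]. *)
exists fs => //; rewrite -ga fsg //; apply/seteqP; split=> z.
  by move=> [y _ <-]; rewrite inA; exact: (fsP y).1.
by rewrite inA => az; exists (g z); rewrite ?fsg.
Qed.
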